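(* Let $A \in \mathbb{C}^{n \times n}$ be a Hermitian matrix having at least $m$ eigenvalues (counted with multiplicity) in the interval $[-1,1]$, let $B \in \mathbb{C}^{n \times k}$, and suppose $m > 2k$. Let $q > 0$ and set $t_{\mathrm{quad}} := (\lceil m/k \rceil - 2)^2 / q$. Then for every integer $t \geq 0$ with $t \leq t_{\mathrm{quad}}$, \[ \lambda_{\min}\big(W(t)\big) \leq 4\, \frac{(\lceil m/k \rceil - 2)^2}{q}\, e^{-q}\, \|B\|_F^2. \]
   Context: For $A \in \mathbb{C}^{n\times n}$, $B \in \mathbb{C}^{n \times k}$ and an integer $t \ge 0$, the controllability Gramian is $W(t) := \sum_{i=0}^{t} A^i B B^* (A^* )^i$, where $^*$ denotes conjugate transpose; $\lambda_{\min}$ denotes its smallest eigenvalue. $\|B\|_F$ is the Frobenius norm. *)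

(* Defs.v *)
From HB Require Import structures.
From mathcomp Require Import all_boot all_order all_algebra.
From mathcomp Require Import complex.
From mathcomp Require Import reals.

Set Implicit Arguments.
Unset Strict Implicit.
Unset Printing Implicit Defensive.

Import Order.TTheory GRing.Theory Num.Theory.
Local Open Scope ring_scope.

Section Defs.
Variable R : rcfType.
Local Notation C := R[i].

Definition ctrmx (p q : nat) (A : 'M[C]_(p, q)) : 'M[C]_(q, p) :=
  (map_mx (@conjc R) A)^T.

Definition hermitian_mx (n : nat) (A : 'M[C]_n) : Prop := ctrmx A = A.

Definition eigenvalue_seq (n : nat) (A : 'M[C]_n) (s : seq C) : bool :=
  char_poly A == \prod_(z <- s) ('X - z%:P).

Lemma eigenvalue_seq_exists (n : nat) (A : 'M[C]_n) :
  exists s, eigenvalue_seq A s.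
Proof.
have [s Hs] := closed_field_poly_normal (char_poly A).
exists s; apply/eqP; rewrite {1}Hs.
by move/monicP: (char_poly_monic A) => ->; rewrite scale1r.
Qed.

Definition eigenvalues (n : nat) (A : 'M[C]_n) : seq C :=
  xchoose (eigenvalue_seq_exists A).

Definition in_unit_interval (z : C) : bool :=
  (complex.Im z == 0) && (-1 <= complex.Re z <= 1).

(* smallest eigenvalue (real part; eigenvalues of Hermitian matrices are real) *)
Definition lambda_min (n : nat) (A : 'M[C]_n) : R :=
  let s := map (@complex.Re R) (eigenvalues A) in foldr Num.min (head 0 s) s.

Definition gramian (n k : nat) (A : 'M[C]_n) (B : 'M[C]_(n, k)) (t : nat)
  : 'M[C]_n :=
  \sum_(i < t.+1) (A ^+ i *m B *m ctrmx B *m (ctrmx A) ^+ i).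

Definition frob2 (p q : nat) (B : 'M[C]_(p, q)) : R :=
  \sum_(i < p) \sum_(j < q) (complex.Re (B i j) ^+ 2 + complex.Im (B i j) ^+ 2).

End Defs.

(* Main.v *)
Require Import Defs.
From HB Require Import structures.
From mathcomp Require Import all_boot all_order all_algebra.
From mathcomp Require Import complex.
From mathcomp Require Import all_classical all_reals all_analysis.
From mathcomp Require Import ring lra.

(* With d = ceil(m/k) - 2 there are k(d+1) < m linear conditions v A^j B = 0,
   j <= d, so some nonzero v in the sum of the eigenspaces of A for eigenvalues
   in [-1,1] satisfies all of them.  Then v A^s B = v (A^s - p(A)) B for every
   polynomial p of degree at most d.  Expanding x^s in Chebyshev polynomials,
   which gives nonnegative coefficients w_j, and truncating at degree d leaves
   an error of at most the sum of the w_j with j > d on [-1,1].  Since T_j(y)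
   is nondecreasing in j for y >= 1, this sum is at most y^s / T_d(y), and
   y = cosh(d/s) yields 2 exp(-d^2/(2s)).  Summing the squares over s = 1..t
   bounds the Rayleigh quotient of W(t) at v. *)

Import Order.TTheory GRing.Theory Num.Theory.
Import numFieldNormedType.Exports.
Local Open Scope ring_scope.

(** * Polynomial approximation of powers on [-1,1] *)

Fixpoint chebyshev_poly (R : comNzRingType) (n : nat) : {poly R} :=
  match n with
  | 0 => 1
  | n'.+1 => if n' is n''.+1
             then 2 *: 'X * chebyshev_poly R n' - chebyshev_poly R n''
             else 'X
  end.

Lemma chebyshev_polySS (R : comNzRingType) n :
  chebyshev_poly R n.+2 =
  2 *: 'X * chebyshev_poly R n.+1 - chebyshev_poly R n.
Proof. by []. Qed.

Lemma size_chebyshev_poly (R : comNzRingType) n :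
  (size (chebyshev_poly R n) <= n.+1)%N.
Proof.
suff: (size (chebyshev_poly R n) <= n.+1)%N /\
      (size (chebyshev_poly R n.+1) <= n.+2)%N by case.
elim: n => [|n [IH0 IH1]]; first by rewrite /= size_poly1 size_polyX.
split=> //; rewrite chebyshev_polySS.
apply: leq_trans (size_polyD _ _) _; rewrite geq_max size_polyN.
rewrite (leq_trans IH0) ?andbT; last by rewrite -addn2 leq_addr.
rewrite -scalerAl (leq_trans (size_scale_leq _ _))//.
by rewrite (leq_trans (size_polyMleq _ _))// size_polyX.
Qed.

Lemma horner_chebyshevSS (R : comNzRingType) (x : R) n :
  (chebyshev_poly R n.+2).[x] =
  2 * x * (chebyshev_poly R n.+1).[x] - (chebyshev_poly R n).[x].
Proof. by rewrite chebyshev_polySS hornerD hornerN hornerM !hornerE. Qed.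

(** Because z w = 1, the half sums obey the Chebyshev recurrence. With z = exp(l) and w = exp(-l)
    this reads T_n(cosh l) = cosh(n l). *)
Lemma horner_chebyshev_half_sum (R : numFieldType) (z w : R) n : z * w = 1 ->
  (chebyshev_poly R n).[(z + w) / 2] = (z ^+ n + w ^+ n) / 2.
Proof.
move=> zw.
suff: (chebyshev_poly R n).[(z + w) / 2] = (z ^+ n + w ^+ n) / 2 /\
      (chebyshev_poly R n.+1).[(z + w) / 2] = (z ^+ n.+1 + w ^+ n.+1) / 2
  by case.
elim: n => [|n [IH0 IH1]].
  by rewrite /= hornerX hornerC !expr0 !expr1; split=> //; field.
split=> //; rewrite horner_chebyshevSS IH0 IH1.
have -> : z ^+ n.+2 + w ^+ n.+2 =
    (z + w) * (z ^+ n.+1 + w ^+ n.+1) - z * w * (z ^+ n + w ^+ n).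
  by rewrite !exprS; ring.
by rewrite zw; field.
Qed.

Section ChebyshevReal.
Context {R : realType}.
Local Notation T := (chebyshev_poly R).
Implicit Types (x y l : R) (n d s : nat).

Lemma horner_chebyshev_cos x n : (T n).[cos x] = cos (n%:R * x).
Proof.
suff: (T n).[cos x] = cos (n%:R * x) /\ (T n.+1).[cos x] = cos (n.+1%:R * x)
  by case.
elim: n => [|n [IH0 IH1]].
  by rewrite /= hornerX hornerC mul0r mul1r cos0.
split=> //; rewrite horner_chebyshevSS IH0 IH1.
have -> : n.+2%:R * x = n.+1%:R * x + x by rewrite -[n.+2]addn1 natrD; ring.
have -> : n%:R * x = n.+1%:R * x - x by rewrite -[n.+1]addn1 natrD; ring.
by rewrite !cosD cosN sinN; ring.
Qed.

Lemma norm_horner_chebyshev_le1 x n : `|x| <= 1 -> `|(T n).[x]| <= 1.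
Proof.
rewrite ler_norml => x1; rewrite -(@acosK _ x) ?in_itv //.
by rewrite horner_chebyshev_cos ler_norml cos_geN1 cos_le1.
Qed.

Lemma horner_chebyshev_homo y : 1 <= y ->
  {homo (fun n => (T n).[y]) : m n / (m <= n)%N >-> m <= n}.
Proof.
(* The bound 1 <= T_n(y) is carried along because the induction uses T_{n+1}(y) >= 0: then 2y
   T_{n+1} - T_n >= 2 T_{n+1} - T_n >= T_{n+1}. *)
move=> y1; suff H n : 1 <= (T n).[y] /\ (T n).[y] <= (T n.+1).[y].
  by apply: homo_leq => [//||n]; [exact: le_trans|case: (H n)].
elim: n => [|n [IH0 IH1]]; first by rewrite /= hornerX hornerC.
split; first exact: le_trans IH0 IH1.
by rewrite horner_chebyshevSS; nra.
Qed.

(* The random walk expansion: multiplying by ['X] spreads the weight of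
   [T j] evenly over [T j.-1] and [T j.+1]. *)
Lemma exprX_chebyshev_expansion s :
  exists2 L : seq (R * nat), all (fun a => 0 <= a.1) L
    & 'X^s = \sum_(a <- L) a.1 *: T a.2.
Proof.
elim: s => [|s [L L0 XE]].
  by exists [:: (1, 0%N)]; rewrite /= ?ler01// big_seq1 scale1r.
rewrite exprS {}XE; elim: L L0 => [|[a j] L IH].
  by exists [::]; rewrite // !big_nil mulr0.
move=> /= /andP[a0 /IH[L' L'0 E]].
(* T_0 has no lower neighbour: X T_0 = T_1, so its whole weight moves up. *)
case: j => [|j].
  exists ((a, 1%N) :: L'); first by rewrite /= a0.
  by rewrite !big_cons mulrDr E /= -scalerAr mulr1.
exists [:: (a / 2, j), (a / 2, j.+2) & L'].
  by rewrite /= divr_ge0.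
rewrite !big_cons mulrDr E addrA; congr (_ + _).
rewrite [(_, _).2]/= chebyshev_polySS scalerBr addrC subrK -scalerAl.
by rewrite /fst scalerA -scalerAr divfK ?pnatr_eq0.
Qed.

(** For j > d, |T_j(x)| <= 1 on [-1,1] and T_d(y) <= T_j(y). Hence the tail weight times T_d(y) is
    at most the tail of the same expansion evaluated at y, which is at most y^s. *)
Lemma chebyshev_truncation s d y : 1 <= y ->
  exists2 p : {poly R}, (size p <= d.+1)%N &
    forall x, `|x| <= 1 -> `|x ^+ s - p.[x]| * (T d).[y] <= y ^+ s.
Proof.
move=> y1; have [L L0 XE] := exprX_chebyshev_expansion s.
have T1 n : 1 <= (T n).[y].
  by rewrite -[1](hornerC 1 y) (@horner_chebyshev_homo y y1 0%N n).
have L0' a : a \in L -> 0 <= a.1 by exact: (allP L0).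
exists (\sum_(a <- L | (a.2 <= d)%N) a.1 *: T a.2).
  apply: leq_trans (size_sum _ _ _) _; apply/bigmax_leqP_seq => a _ ad.
  by rewrite (leq_trans (size_scale_leq _ _))//
     (leq_trans (size_chebyshev_poly _ _)).
move=> x x1.
have powE z : z ^+ s = \sum_(a <- L) a.1 * (T a.2).[z].
  rewrite -[z in LHS]hornerX -horner_exp XE horner_sum.
  by apply: eq_bigr => a _; rewrite hornerZ.
rewrite !powE (bigID (fun a => (a.2 <= d)%N)) /= horner_sum.
under [X in _ - X]eq_bigr do rewrite hornerZ.
rewrite addrAC subrr add0r [X in _ <= X](bigID (fun a => (a.2 <= d)%N)) /=.
(* The low-index terms of y^s are nonnegative and are compared with 0; the tails are compared term
   by term. *)
rewrite -[X in X <= _]add0r.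
apply: lerD.
  rewrite big_seq_cond sumr_ge0// => a /andP[aL _].
  by rewrite mulr_ge0 ?L0' ?(le_trans ler01).
rewrite (le_trans (ler_wpM2r _ (ler_norm_sum _ _ _))) ?(le_trans ler01)//.
rewrite mulr_suml [X in X <= _]big_seq_cond [X in _ <= X]big_seq_cond.
apply: ler_sum => a /andP[aL]; rewrite -ltnNge => ad.
rewrite normrM (ger0_norm (L0' _ aL)) -mulrA ler_wpM2l ?L0'//.
apply: le_trans (_ : 1 * (T d).[y] <= _).
  by rewrite ler_wpM2r ?norm_horner_chebyshev_le1 ?(le_trans ler01).
by rewrite mul1r horner_chebyshev_homo// ltnW.
Qed.

(** * Gaussian bound on the hyperbolic cosine and the resulting approximation rate *)

Lemma expR_sub_le_mulr_add x : 0 <= x ->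
  expR x - expR (- x) <= x * (expR x + expR (- x)).
Proof.
(* Here f is twice z cosh z - sinh z; it vanishes at 0 and its derivative 2 z sinh z is nonnegative
   for z >= 0. *)
move=> x0; pose f (z : R) := z * (expR z + expR (- z)) - (expR z - expR (- z)).
have df (z : R) : is_derive z 1 f (z * (expR z - expR (- z))).
  by rewrite /f; apply: is_derive_eq; rewrite /GRing.scale /=; ring.
rewrite -subr_ge0 -/(f x).
have <- : f 0 = 0 by rewrite /f mul0r oppr0 !subrr.
apply: (@ger0_derive1_le_cc _ f 0 x); rewrite ?in_itv /= ?lexx ?x0//.
- move=> z; rewrite in_itv /= => /andP[z0 _].
  rewrite derive1E derive_val mulr_ge0 ?ltW// subr_gt0 ltr_expR; lra.
- by apply: derivable_within_continuous => z _.
Qed.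

Lemma expR_half_sum_le x : (expR x + expR (- x)) / 2 <= expR (x ^+ 2 / 2).
Proof.
wlog x0 : x / 0 <= x.
  move=> H; have [/H//|/ltW x0] := leP 0 x.
  by have := H (- x); rewrite opprK sqrrN addrC oppr_ge0; exact.
(* Here f is twice exp(-z^2/2) cosh z. Its derivative has the sign of sinh z - z cosh z, which is
   nonpositive for z >= 0, so f(x) <= f(0) = 2. *)
pose f (z : R) := expR (- (z ^+ 2 / 2)) * (expR z + expR (- z)).
have df (z : R) : is_derive z 1 f
    (expR (- (z ^+ 2 / 2)) * (expR z - expR (- z) - z * (expR z + expR (- z)))).
  by rewrite /f; apply: is_derive_eq; rewrite /GRing.scale /=; field.
have : f x <= f 0.
  apply: (@ler0_derive1_le_cc _ f 0 x); rewrite ?in_itv /= ?lexx ?x0//.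
  - move=> z; rewrite in_itv /= => /andP[z0 _].
    rewrite derive1E derive_val mulr_ge0_le0 ?expR_ge0// subr_le0.
    by rewrite expR_sub_le_mulr_add// ltW.
  - by apply: derivable_within_continuous => z _.
rewrite /f expr0n mul0r oppr0 expR0 mul1r ler_pdivrMr// expRN.
by rewrite mulrC ler_pdivrMr ?expR_gt0// [expR _ * 2]mulrC.
Qed.

Lemma exprX_approx s d : (0 < s)%N ->
  exists2 p : {poly R}, (size p <= d.+1)%N &
    forall x, `|x| <= 1 ->
      `|x ^+ s - p.[x]| <= 2 * expR (- (d%:R ^+ 2 / (2 * s%:R))).
Proof.
move=> s0; have s0' : s%:R != 0 :> R by rewrite pnatr_eq0 -lt0n.
(* For y = cosh l the truncation error is at most y^s / T_d(y) <= 2 exp(s l^2/2 - d l); l = d/s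
   minimizes this exponent. *)
pose l : R := d%:R / s%:R.
pose y := (expR l + expR (- l)) / 2.
have El : expR l * expR (- l) = 1 by rewrite -expRD subrr expR0.
have y1 : 1 <= y.
  have := sqr_ge0 (expR l - 1); have := expR_gt0 l; have := expR_gt0 (- l).
  rewrite /y => *; nra.
have [p sp Hp] := chebyshev_truncation s d y y1; exists p => // x x1.
have := Hp x x1; rewrite horner_chebyshev_half_sum// => Hx.
have yle : y ^+ s <= expR (d%:R ^+ 2 / (2 * s%:R)).
  have -> : d%:R ^+ 2 / (2 * s%:R) = l ^+ 2 / 2 * s%:R.
    by rewrite /l; field.
  by rewrite expRM_natr lerXn2r ?nnegrE ?expR_ge0 ?expR_half_sum_le
     ?(le_trans ler01).
(* With e = exp(d^2/(2s)) this choice of l gives y^s <= e and T_d(y) >= exp(d l)/2 = e^2/2, so the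
   error is at most 2/e. *)
have Ed : expR l ^+ d = expR (d%:R ^+ 2 / (2 * s%:R)) ^+ 2.
  by rewrite -!expRM_natl; congr expR; rewrite /l; field.
set e := expR (d%:R ^+ 2 / _) in yle Ed *.
rewrite expRN -/e.
have e0 : 0 < e by exact: expR_gt0.
have wd0 : 0 <= expR (- l) ^+ d by rewrite exprn_ge0// expR_ge0.
set N := `| _ - _| in Hx *.
rewrite ler_pdivlMr//.
have N0 : 0 <= N by exact: normr_ge0.
rewrite Ed in Hx.
have : N * (e ^+ 2 / 2) <= e.
  by apply: le_trans (le_trans Hx yle); rewrite ler_wpM2l//; lra.
nra.
Qed.

End ChebyshevReal.

(** * Krylov annihilators and the Gramian *)

(** Vanishing outside J amounts to n - |J| linear equations; together with the N columns of [M]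
    there are fewer than n equations in n unknowns. *)
Lemma exists_ker_row_supported (F : fieldType) n N (M : 'M[F]_(n, N))
    (J : {set 'I_n}) : (N < #|J|)%N ->
  exists c : 'rV[F]_n,
    [/\ c != 0, c *m M = 0 & forall i, i \notin J -> c 0 i = 0].
Proof.
move=> NJ.
(* The columns of [Z] are the unit vectors indexed by the complement of J, so c Z = 0 encodes the
   support condition. *)
pose Z := \matrix_(i < n, l < #|~: J|) (i == enum_val l)%:R : 'M[F]_(n, _).
have ker0 : kermx (row_mx M Z) != 0.
  rewrite -mxrank_eq0 mxrank_ker subn_eq0 -ltnNge.
  rewrite (leq_ltn_trans (rank_leq_col _))// -[X in (_ < X)%N]card_ord.
  by rewrite -(cardsC J) ltn_add2r.
exists (nz_row (kermx (row_mx M Z))); rewrite nz_row_eq0; set c := nz_row _.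
have : c *m row_mx M Z = 0 by apply/sub_kermxP/nz_row_sub.
rewrite mul_mx_row -row_mx0 => /eq_row_mx[cM cZ]; split=> // i iJ.
have iJC : i \in ~: J by rewrite inE.
have /matrixP/(_ 0 (enum_rank_in iJC i)) := cZ.
rewrite !mxE (bigD1 i)//= !mxE enum_rankK_in// eqxx mulr1 big1 ?addr0// => j ji.
by rewrite !mxE enum_rankK_in// (negbTE ji) mulr0.
Qed.

(** Meant for eigencoordinates: [x] lists eigenvalues and [G] is [B] in the eigenbasis. The powers
    x^0, ..., x^d against k columns give k(d+1) equations, and linearity extends them to all
    polynomials of degree at most d. *)
Lemma exists_krylov_annihilator (F : fieldType) n k d (x : 'I_n -> F)
    (G : 'M[F]_(n, k)) (J : {set 'I_n}) : (k * d.+1 < #|J|)%N ->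
  exists c : 'rV[F]_n,
    [/\ c != 0, forall i, i \notin J -> c 0 i = 0 &
        forall (p : {poly F}) l, (size p <= d.+1)%N ->
          \sum_i c 0 i * p.[x i] * G i l = 0].
Proof.
move=> kJ.
pose M := \matrix_(i < n, a < #|{: 'I_d.+1 * 'I_k}|)
  (x i ^+ (enum_val a).1 * G i (enum_val a).2).
have [|c [c0 cM cJ]] := @exists_ker_row_supported F n _ M J.
  by rewrite card_prod !card_ord mulnC.
exists c; split=> // p l sp.
have vanish (j : 'I_d.+1) : \sum_i c 0 i * (x i ^+ j * G i l) = 0.
  have /matrixP/(_ 0 (enum_rank (j, l))) := cM; rewrite !mxE => cM0.
  by rewrite -[RHS]cM0; apply: eq_bigr => i _; rewrite !mxE enum_rankK.
under eq_bigr do rewrite (horner_coef_wide _ sp) mulr_sumr mulr_suml.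
rewrite exchange_big big1 //= => j _.
transitivity (p`_j * \sum_i c 0 i * (x i ^+ j * G i l)).
  by rewrite mulr_sumr; apply: eq_bigr => i _; ring.
by rewrite vanish mulr0.
Qed.

Lemma char_poly_unit_conj (F : comUnitRingType) n (P A : 'M[F]_n) :
  P \in unitmx -> char_poly (invmx P *m A *m P) = char_poly A.
Proof.
move=> uP; have PP : map_mx polyC (invmx P) *m map_mx polyC P = 1%:M.
  by rewrite -map_mxM mulVmx// map_mx1.
have -> : char_poly (invmx P *m A *m P) =
    \det (map_mx polyC (invmx P) *m char_poly_mx A *m map_mx polyC P).
  congr (\det _); rewrite /char_poly_mx !map_mxM mulmxBr mulmxBl.
  by rewrite scalar_mxC -(mulmxA 'X%:M) PP mulmx1.
by rewrite !det_mulmx mulrAC -det_mulmx PP det1 mul1r.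
Qed.

(** * Conjugate transpose and the squared Frobenius norm *)

Section ComplexMatrices.
Context {R : realType}.
Local Notation C := R[i].
Local Notation "x %:C" := (real_complex R x).
Local Open Scope sesquilinear_scope.

Lemma ctrmxE {m n} (A : 'M[C]_(m, n)) : ctrmx A = A ^t*.
Proof. by rewrite /ctrmx map_trmx. Qed.

Lemma ctrmx_mul {m n p} (A : 'M[C]_(m, n)) (B : 'M[C]_(n, p)) :
  ctrmx (A *m B) = ctrmx B *m ctrmx A.
Proof. by rewrite /ctrmx map_mxM trmx_mul. Qed.

Lemma ctrmxK {m n} (A : 'M[C]_(m, n)) : ctrmx (ctrmx A) = A.
Proof. by rewrite !ctrmxE trmxCK. Qed.

Lemma frob2_sum_norm {m n} (A : 'M[C]_(m, n)) :
  (frob2 A)%:C = \sum_i \sum_j `|A i j| ^+ 2.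
Proof.
rewrite /frob2 rmorph_sum; apply: eq_bigr => i _.
by rewrite rmorph_sum; apply: eq_bigr => j _; exact: add_Re2_Im2.
Qed.

Lemma frob2_mxtrace {m n} (A : 'M[C]_(m, n)) :
  (frob2 A)%:C = \tr (A *m ctrmx A).
Proof.
rewrite frob2_sum_norm; apply: eq_bigr => i _; rewrite mxE.
by apply: eq_bigr => j _; rewrite !mxE sqr_normc.
Qed.

Lemma frob2_ge0 {m n} (A : 'M[C]_(m, n)) : 0 <= frob2 A.
Proof.
rewrite /frob2 !sumr_ge0// => i _; rewrite sumr_ge0// => j _.
by rewrite addr_ge0 ?sqr_ge0.
Qed.

Lemma frob2_gt0 {m n} (A : 'M[C]_(m, n)) : A != 0 -> 0 < frob2 A.
Proof.
move=> A0; rewrite lt0r frob2_ge0 andbT; apply: contra A0 => /eqP f0.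
have := frob2_sum_norm A; rewrite f0 => /esym/eqP.
rewrite psumr_eq0 => [/allP H|i _]; last first.
  by rewrite sumr_ge0// => j _; rewrite exprn_ge0.
apply/eqP/matrixP => i j; rewrite mxE.
have := H i (mem_index_enum i); rewrite /= psumr_eq0 => [/allP/(_ j)|j' _].
  by rewrite mem_index_enum expf_eq0 normr_eq0 /= => /(_ isT)/eqP.
by rewrite exprn_ge0.
Qed.

Lemma frob2_unitaryl {m n} (P : 'M[C]_m) (A : 'M[C]_(m, n)) :
  P \is unitarymx -> frob2 (P *m A) = frob2 A.
Proof.
move=> uP; apply: (@complexI R); rewrite !frob2_mxtrace ctrmx_mul.
rewrite mulmxA mxtrace_mulC !mulmxA ctrmxE -invmx_unitary// mulVmx ?mul1mx//.
exact: unitarymx_unit.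
Qed.

Lemma frob2_unitaryr {m n} (P : 'M[C]_n) (A : 'M[C]_(m, n)) :
  P \is unitarymx -> frob2 (A *m P) = frob2 A.
Proof.
move=> /unitarymxP uP; apply: (@complexI R); rewrite !frob2_mxtrace ctrmx_mul.
by rewrite -mulmxA (mulmxA P) [ctrmx P]ctrmxE uP mul1mx.
Qed.

(** Cauchy-Schwarz for each column of [G], summed over the columns. *)
Lemma frob2_rowmul_le {n k} (u : 'rV[C]_n) (G : 'M[C]_(n, k)) :
  frob2 (u *m G) <= frob2 u * frob2 G.
Proof.
rewrite -lecR rmorphM /= !frob2_sum_norm !big_ord1.
rewrite [X in _ <= _ * X]exchange_big /=.
rewrite mulr_sumr; apply: ler_sum => l _.
(* [dotmx] conjugates its second argument, so the column is conjugated beforehand. *)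
pose g : 'rV[C]_n := (col l G)^t*.
have : `|dotmx u g| ^+ 2 <= dotmx u u * dotmx g g.
  by have [] := CauchySchwarz (@dotmx C n) u g.
have -> : dotmx u g = (u *m G) 0 l.
  by rewrite dotmxE !mxE; apply: eq_bigr => i _; rewrite !mxE conjCK.
have dotmx_sum (w : 'rV[C]_n) : dotmx w w = \sum_i `|w 0 i| ^+ 2.
  by rewrite dotmxE mxE; apply: eq_bigr => i _; rewrite !mxE normCK.
rewrite !dotmx_sum; suff -> : \sum_i `|g 0 i| ^+ 2 = \sum_i `|G i l| ^+ 2 by [].
by apply: eq_bigr => i _; rewrite !mxE norm_conjC.
Qed.

(** * Unitary diagonalization and the Rayleigh bound *)

Lemma hermitian_spectral {n} (A : 'M[C]_n) : hermitian_mx A ->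
  exists (P : 'M[C]_n) (D : 'rV[C]_n),
    P \is unitarymx /\ A = ctrmx P *m diag_mx D *m P.
Proof.
move=> hA; have nA : A \is normalmx by apply/normalmxP; rewrite -ctrmxE hA.
exists (spectralmx A), (spectral_diag A).
split; first exact: spectral_unitarymx.
by rewrite ctrmxE -invmx_unitary ?spectral_unitarymx//; exact/orthomx_spectralP.
Qed.

(** Linear factors of the characteristic polynomial are unique up to order. Eigenvalue counts, and
    the sequence selected by choice in [eigenvalues], can therefore be read off [D]. *)
Lemma eigenvalue_seq_unitary_diag {n} (P : 'M[C]_n) (D : 'rV[C]_n) s :
  P \is unitarymx ->
  eigenvalue_seq (ctrmx P *m diag_mx D *m P) s =
  perm_eq s [seq D 0 i | i : 'I_n].
Proof.
move=> uP; rewrite /eigenvalue_seq.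
have -> : char_poly (ctrmx P *m diag_mx D *m P) =
    \prod_(z <- [seq D 0 i | i : 'I_n]) ('X - z%:P).
  rewrite ctrmxE -invmx_unitary//.
  rewrite char_poly_unit_conj ?unitarymx_unit//.
  rewrite char_poly_trig ?diag_mx_is_trig//.
  by rewrite big_image; apply: eq_bigr => i _; rewrite mxE eqxx.
apply/eqP/idP => [/prod_XsubC_eq|H]; first by rewrite perm_sym.
by rewrite (perm_big _ H).
Qed.

Lemma lambda_min_le {n} (A : 'M[C]_n) z :
  z \in eigenvalues A -> lambda_min A <= complex.Re z.
Proof.
rewrite /lambda_min => zA.
(* The bound holds for any seed of the fold; generalizing it lets the induction on the list go
   through. *)
move: (head _ _) => h.
have : complex.Re z \in map (@complex.Re R) (eigenvalues A).
  exact: map_f.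
elim: map => //= a s IH; rewrite inE ge_min => /orP[/eqP->|/IH->].
  by rewrite lexx.
by rewrite orbT.
Qed.

(** In the eigenbasis of [W], with u = v P*, the form is the sum of D_i |u_i|^2; each Re D_i is at
    least [lambda_min W], and u has the norm of v. *)
Lemma lambda_min_rayleigh {n} (W : 'M[C]_n) (v : 'rV[C]_n) : hermitian_mx W ->
  lambda_min W * frob2 v <= complex.Re ((v *m W *m ctrmx v) 0 0).
Proof.
move=> hW; have [P [D [uP WE]]] := hermitian_spectral W hW.
have DW i : lambda_min W <= complex.Re (D 0 i).
  apply: lambda_min_le; have := xchooseP (eigenvalue_seq_exists W).
  rewrite -/(eigenvalues W) {1}WE eigenvalue_seq_unitary_diag// => /perm_mem->.
  by apply/mapP; exists i; rewrite ?mem_enum.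
have uP' : ctrmx P \is unitarymx by rewrite ctrmxE trmxC_unitary.
pose u := v *m ctrmx P.
have -> : v *m W *m ctrmx v = u *m diag_mx D *m ctrmx u.
  by rewrite {1}WE /u ctrmx_mul ctrmxK !mulmxA.
rewrite -(frob2_unitaryr _ v uP') -/u; clearbody u.
rewrite /frob2 big_ord1 mulr_sumr mxE.
rewrite (raddf_sum (@complex.Re R : Rcomplex R -> R)).
apply: ler_sum => i _; rewrite mul_mx_diag !mxE /=.
have ReM (r : R) (z : C) : complex.Re (r%:C * z) = r * complex.Re z.
  by case: z => a b /=; rewrite mul0r subr0.
rewrite mulrAC -sqr_normc -add_Re2_Im2.
apply: le_trans (_ : _ <= _ * complex.Re (D 0 i)) _; last first.
  by rewrite -ReM.
by rewrite mulrC ler_wpM2l// addr_ge0 ?sqr_ge0.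
Qed.

(** * The Gramian as a sum of squares *)

Lemma ctrmx_exp {n} (A : 'M[C]_n) s : ctrmx (A ^+ s) = ctrmx A ^+ s.
Proof.
elim: s => [|s IH]; first by rewrite !expr0 /ctrmx map_mx1 trmx1.
by rewrite exprS exprSr -IH; exact: ctrmx_mul.
Qed.

Lemma gramianE {n k} (A : 'M[C]_n) (B : 'M[C]_(n, k)) t :
  gramian A B t = \sum_(s < t.+1) (A ^+ s *m B) *m ctrmx (A ^+ s *m B).
Proof. by apply: eq_bigr => s _; rewrite ctrmx_mul ctrmx_exp !mulmxA. Qed.

Lemma hermitian_gramian {n k} (A : 'M[C]_n) (B : 'M[C]_(n, k)) t :
  hermitian_mx (gramian A B t).
Proof.
rewrite /hermitian_mx gramianE {1}/ctrmx map_mx_sum raddf_sum.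
apply: eq_bigr => s _.
transitivity (ctrmx (A ^+ s *m B *m ctrmx (A ^+ s *m B))) => //.
by rewrite ctrmx_mul ctrmxK.
Qed.

Lemma gramian_quadratic_form {n k} (A : 'M[C]_n) (B : 'M[C]_(n, k)) t
    (v : 'rV[C]_n) :
  complex.Re ((v *m gramian A B t *m ctrmx v) 0 0) =
  \sum_(s < t.+1) frob2 (v *m A ^+ s *m B).
Proof.
rewrite gramianE mulmx_sumr mulmx_suml summxE.
rewrite (raddf_sum (@complex.Re R : Rcomplex R -> R)).
apply: eq_bigr => s _; apply: (@complexI R).
have -> : v *m (A ^+ s *m B *m ctrmx (A ^+ s *m B)) *m ctrmx v =
    (v *m A ^+ s *m B) *m ctrmx (v *m A ^+ s *m B).
  by rewrite !ctrmx_mul !mulmxA.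
by rewrite -trace_mx11 -frob2_mxtrace.
Qed.

(** * Krylov rows in eigencoordinates *)

Lemma mulmx_row_exp_diag {n} (P : 'M[C]_n) (D c : 'rV[C]_n) s :
  P \is unitarymx ->
  c *m P *m (ctrmx P *m diag_mx D *m P) ^+ s =
  (\row_i (c 0 i * D 0 i ^+ s)) *m P.
Proof.
move=> /unitarymxP uP; elim: s => [|s IH].
  rewrite expr0; transitivity (c *m P); first exact: mulmx1.
  by congr (_ *m _); apply/rowP => i; rewrite !mxE expr0 mulr1.
(* P P* = 1 cancels between consecutive factors, so each power of the matrix multiplies coordinate i
   by D_i. *)
rewrite exprSr (mulmxA (c *m P) _ _) {}IH 2!mulmxA.
rewrite -(mulmxA _ P) [ctrmx P]ctrmxE uP mulmx1.
congr (_ *m _); apply/rowP => i.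
by rewrite mul_mx_diag !mxE exprSr mulrA.
Qed.

Lemma frob2_row_scale_le {n} (c : 'rV[C]_n) (r : 'I_n -> R) e :
  (forall i, c 0 i != 0 -> `|r i| <= e) ->
  frob2 (\row_i (c 0 i * (r i)%:C)) <= e ^+ 2 * frob2 c.
Proof.
move=> re; rewrite /frob2 !big_ord1 mulr_sumr; apply: ler_sum => i _.
rewrite !mxE; have [->|/re ri] := eqVneq (c 0 i) 0.
  by rewrite mul0r /= expr0n addr0 mulr0.
have : `|r i| ^+ 2 <= e ^+ 2 by rewrite lerXn2r ?nnegrE ?(le_trans _ ri).
case: (c 0 i) => a b /=; rewrite real_normK ?num_real// => re2.
have -> : (a * r i - b * 0) ^+ 2 + (a * 0 + b * r i) ^+ 2 =
  r i ^+ 2 * (a ^+ 2 + b ^+ 2) by ring.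
by rewrite ler_wpM2r// addr_ge0 ?sqr_ge0.
Qed.

(** Take v = c P with c supported on the eigenvalues in [-1,1]. Since c annihilates polynomials of
    degree at most d, the approximant of x^s can be subtracted without changing v A^s B, leaving
    only the uniform error. *)
Lemma exists_row_krylov_small n k d (A : 'M[C]_n) (B : 'M[C]_(n, k)) z :
  hermitian_mx A -> eigenvalue_seq A z ->
  (k * d.+1 < count (@in_unit_interval R) z)%N ->
  exists v : 'rV[C]_n, [/\ v != 0, v *m B = 0 &
    forall s, (0 < s)%N -> frob2 (v *m A ^+ s *m B) <=
      4 * expR (- (d%:R ^+ 2 / s%:R)) * frob2 v * frob2 B].
Proof.
move=> /hermitian_spectral[P [D [uP ->]]].
rewrite eigenvalue_seq_unitary_diag// => /permP-> kd.
pose J := [set i | in_unit_interval (D 0 i)].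
have [|c [c0 cJ cK]] := exists_krylov_annihilator _ n k d (D 0) (P *m B) J.
  move: kd; rewrite count_map cardE [enum J]/enum_mem size_filter enumT.
  by congr (_ < _)%N; apply: eq_count => i; rewrite /= inE.
exists (c *m P); split.
- apply: contra c0 => /eqP cP0.
  by rewrite -(mulmxK (unitarymx_unit uP) c) cP0 mul0mx.
- apply/rowP => l; rewrite -mulmxA mxE [RHS]mxE -[RHS](cK 1 l) ?size_poly1//.
  by apply: eq_bigr => i _; rewrite hornerC mulr1.
move=> s s0; have [p sp pP] := @exprX_approx R s d s0.
pose x i := complex.Re (D 0 i).
have -> : c *m P *m (ctrmx P *m diag_mx D *m P) ^+ s *m B =
    (\row_i (c 0 i * (x i ^+ s - p.[x i])%:C)) *m (P *m B).
  rewrite mulmx_row_exp_diag// -mulmxA; apply/rowP => l.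
  rewrite [LHS]mxE [RHS]mxE.
  (* The subtracted 0 is rewritten as the annihilated sum for p, with coefficients mapped into the
     complex field. *)
  rewrite -[LHS]subr0 -
     [X in _ - X = _](cK (map_poly (real_complex R) p) l) ?size_map_poly//.
  rewrite -sumrB; apply: eq_bigr => i _; rewrite 2!(mxE _ _ 0 i).
  have [iJ|/cJ ->] := boolP (i \in J); last by rewrite !mul0r subr0.
  (* Membership in J includes a zero imaginary part, so this eigenvalue equals its real part. *)
  have Dx : D 0 i = (x i)%:C.
    move: iJ; rewrite inE /x => /andP[]; case: (D 0 i) => a b /= /eqP->.
    by [].
  by rewrite Dx horner_map rmorphB rmorphXn /=; ring.
apply: le_trans (frob2_rowmul_le _ _) _.
rewrite !(frob2_unitaryl, frob2_unitaryr)// ler_wpM2r ?frob2_ge0//.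
have -> : 4 * expR (- (d%:R ^+ 2 / s%:R)) =
    (2 * expR (- (d%:R ^+ 2 / (2 * s%:R)))) ^+ 2 :> R.
  rewrite exprMn -expRM_natl; congr (_ * expR _); first by rewrite -natrX.
  by field; rewrite pnatr_eq0 -lt0n.
apply: frob2_row_scale_le => i ci0; apply: pP.
have : i \in J by apply: contraR ci0 => /cJ->.
by rewrite inE => /andP[_]; rewrite ler_norml.
Qed.

End ComplexMatrices.

(** * Summation over the time steps *)

Theorem theorem2 (R : realType) (n k m : nat)
  (A : 'M[R[i]]_n) (B : 'M[R[i]]_(n, k)) (q : R) :
  (0 < k)%N ->
  hermitian_mx A ->
  (exists s, eigenvalue_seq A s /\ (m <= count (@in_unit_interval R) s)%N) ->
  (2 * k < m)%N ->
  0 < q ->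
  forall t : nat,
    (t%:R <= ((Num.ceil (m%:R / k%:R : R))%:~R - 2) ^+ 2 / q :> R) ->
    lambda_min (gramian A B t)
      <= 4 * (((Num.ceil (m%:R / k%:R : R))%:~R - 2) ^+ 2 / q)
           * expR (- q) * frob2 B.
Proof.
move=> k0 hA [z [zA mz]] km q0 t.
have k0' : 0 < k%:R :> R by rewrite ltr0n.
have [d -> kdm] : exists2 d : nat,
    (Num.ceil (m%:R / k%:R : R))%:~R - 2 = d%:R :> R & (k * d.+1 < m)%N.
  (* m > 2k forces the ceiling to be at least 3. Writing it as d+3, the witness is d+1, and d+2
     lying below the ceiling gives k(d+2) < m. *)
  have : (2%:Z < Num.ceil (m%:R / k%:R : R)).
    by rewrite ceil_gt_int ltr_pdivlMr// -natrM ltr_nat.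
  case E : (Num.ceil _) => [[|[|[|d]]]|//] // _; exists d.+1.
    by rewrite -[d.+3]addn2 PoszD intrD addrK.
  have : (d.+2%:Z < Num.ceil (m%:R / k%:R : R)) by rewrite E ltz_nat.
  by rewrite ceil_gt_int ltr_pdivlMr// -natrM ltr_nat mulnC.
set T := d%:R ^+ 2 / q => tT.
have [v [v0 vB vA]] :=
  exists_row_krylov_small n k d A B z hA zA (leq_trans kdm mz).
rewrite -(ler_pM2r (frob2_gt0 v v0)).
apply: le_trans (lambda_min_rayleigh _ v (hermitian_gramian A B t)) _.
(* The term s = 0 is split off and vanishes because v B = 0; thus t terms remain instead of t+1, and
   the final factor is t <= T. *)
rewrite gramian_quadratic_form big_ord_recl expr0.
have -> : v *m 1 *m B = 0 by rewrite -[RHS]vB; congr (_ *m _); exact: mulmx1.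
have -> : frob2 (0 : 'M[R[i]]_(1, k)) = 0.
  rewrite /frob2 !big1// => i _; rewrite big1// => j _.
  by rewrite !mxE /= expr0n addr0.
rewrite add0r.
apply: le_trans (_ : \sum_(s < t) 4 * expR (- q) * frob2 v * frob2 B <= _).
  (* The actual power is s+1 <= t <= d^2/q, so q <= d^2/(s+1) and every exponential is at most
     exp(-q). *)
  apply: ler_sum => s _; apply: le_trans (vA _ _) _ => //.
  rewrite !ler_wpM2r ?frob2_ge0// ler_wpM2l// ler_expR lerN2.
  rewrite ler_pdivlMr ?ltr0n// mulrC -ler_pdivlMr//.
  by apply: le_trans tT; rewrite ler_nat lift0.
rewrite sumr_const card_ord -[X in X <= _]mulr_natr.
have -> : 4 * T * expR (- q) * frob2 B * frob2 v =
  4 * expR (- q) * frob2 v * frob2 B * T by ring.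
by rewrite ler_wpM2l// !mulr_ge0 ?frob2_ge0 ?expR_ge0.
Qed.
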